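(* It is undecidable, given a language $L$ accepted by a one-way deterministic $2$-stack real-time pushdown automaton where both pushdowns are $1$-reversal-bounded, whether $L$ is dense. That is, there is no algorithm which, given any such automaton $M$ with input alphabet $\Sigma$, decides whether $\inf(L(M)) = \Sigma^*$.
   Context: For an alphabet $\Sigma$ and $L \subseteq \Sigma^*$, let $\inf(L) = \{y \in \Sigma^* \mid xyz \in L \text{ for some } x,z \in \Sigma^*\}$. $L$ is dense if $\inf(L) = \Sigma^*$. A one-way deterministic $2$-stack pushdown automaton is a deterministic finite automaton with a one-way read-only input augmented with two pushdown stacks, each with its own bottom-of-stack marker. Each transition depends on the current state, the input letter, and the top symbols of the two stacks, and changes the state and, independently on each stack, pushes, pops, or leaves the stack unchanged. It is real-time if it has no $\lambda$-transitions, i.e. every transition consumes exactly one input letter. A word is accepted if the (unique) computation reads the entire word and ends in a final state. $L(M)$ denotes the set of accepted words. A pushdown is $1$-reversal-bounded if, on every accepting computation, the number of changes of direction between pushing and popping on that pushdown is at most $1$. *)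

(* Defs.v *)
From mathcomp Require Import all_boot.

Set Implicit Arguments.
Unset Strict Implicit.
Unset Printing Implicit Defensive.

Definition language (T : Type) := seq T -> Prop.

Definition inf (T : Type) (L : language T) : language T :=
  fun y => exists x z, L (x ++ y ++ z).

Definition dense (T : Type) (L : language T) : Prop := forall y, inf L y.

Inductive action (G : Type) : Type := Push of G | Pop | Stay.
Arguments Pop {G}.
Arguments Stay {G}.

(* States, input letters and the symbols of the two stacks are initial        *)
(* segments of nat, so that automata are finite objects given by numerals.    *)
(* The bottom-of-stack marker is not a stack symbol: a stack is the sequence  *)
(* of symbols above the marker, topmost first, and its top symbol is None     *)
(* exactly when the marker is exposed. The transition table is partial (an    *)
(* entry None means that the computation blocks), and each of its entries     *)
(* consumes one input letter, so every automaton is real-time.                *)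
Record dpda2 := Dpda2 {
  nstates : nat;
  nletters : nat;
  nsymbols1 : nat;
  nsymbols2 : nat;
  start : 'I_nstates;
  final : {set 'I_nstates};
  trans : {ffun 'I_nstates * 'I_nletters * option 'I_nsymbols1
                * option 'I_nsymbols2 ->
             option ('I_nstates * action 'I_nsymbols1 * action 'I_nsymbols2)}
}.

(* The bottom marker is never removed: Pop is impossible when it is exposed.  *)
Definition act (G : Type) (a : action G) (s : seq G) : option (seq G) :=
  match a with
  | Push g => Some (g :: s)
  | Pop => if s is _ :: s' then Some s' else None
  | Stay => Some s
  end.

Section Semantics.

Variable M : dpda2.

Definition config : Type :=
  'I_(nstates M) * seq 'I_(nsymbols1 M) * seq 'I_(nsymbols2 M).

Definition actions : Type := action 'I_(nsymbols1 M) * action 'I_(nsymbols2 M).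

Definition step (c : config) (a : 'I_(nletters M)) : option (actions * config) :=
  let: (q, s1, s2) := c in
  if trans M (q, a, ohead s1, ohead s2) is Some (q', a1, a2) then
    if (act a1 s1, act a2 s2) is (Some s1', Some s2') then
      Some ((a1, a2), (q', s1', s2'))
    else None
  else None.

(* The stack actions performed while reading w from c, and the configuration  *)
(* reached; None if w is not read entirely.                                   *)
Fixpoint run (c : config) (w : seq 'I_(nletters M)) :
    option (seq actions * config) :=
  if w is a :: w' then
    if step c a is Some (m, c') then
      if run c' w' is Some (ms, c'') then Some (m :: ms, c'') else None
    else None
  else Some ([::], c).

Definition accepting_run (w : seq 'I_(nletters M)) (ms : seq actions) : Prop :=
  exists c : config, run (start M, [::], [::]) w = Some (ms, c) /\
                     c.1.1 \in final M.

Definition lang : language 'I_(nletters M) := fun w => exists ms, accepting_run w ms.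

End Semantics.

Definition direction (G : Type) (a : action G) : option bool :=
  match a with Push _ => Some true | Pop => Some false | Stay => None end.

(* Stay does not affect the direction.                                        *)
Definition reversals (G : Type) (s : seq (action G)) : nat :=
  if pmap (@direction G) s is d :: ds then count id (pairmap addb d ds) else 0.

Definition one_reversal_bounded (M : dpda2) : Prop :=
  forall w ms, @accepting_run M w ms ->
    reversals (unzip1 ms) <= 1 /\ reversals (unzip2 ms) <= 1.

(* Algorithms are the partial recursive functions of Kleene.                  *)
Inductive recf : nat -> Type :=
| Zero : recf 0
| Succ : recf 1
| Proj n : 'I_n -> recf n
| Comp m n : recf m -> ('I_m -> recf n) -> recf n
| Prec n : recf n -> recf n.+2 -> recf n.+1
| Mu n : recf n.+1 -> recf n.

(* eval f xs y : the computation of f on xs terminates with value y. The      *)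
(* recursion of Prec and the search of Mu are on the first argument.          *)
Fixpoint eval n (f : recf n) : n.-tuple nat -> nat -> Prop :=
  match f in recf n return n.-tuple nat -> nat -> Prop with
  | Zero => fun _ y => y = 0
  | Succ => fun xs y => y = (thead xs).+1
  | Proj n i => fun xs y => y = tnth xs i
  | Comp m n f g => fun xs y =>
      exists zs : m.-tuple nat,
        (forall i, eval (g i) xs (tnth zs i)) /\ eval f zs y
  | Prec n f g => fun xs y =>
      (fix rec k v : Prop :=
         if k is k'.+1 then
           exists u, rec k' u /\ eval g [tuple of k' :: u :: behead_tuple xs] v
         else eval f (behead_tuple xs) v) (thead xs) y
  | Mu n f => fun xs y =>
      eval f [tuple of y :: xs] 0 /\
      forall i, i < y -> exists v, eval f [tuple of i :: xs] v.+1
  end.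

(* Decidability of the property Q of the objects of type A satisfying P, each *)
(* given to the algorithm through its code; nothing is required of the        *)
(* algorithm on other inputs.                                                 *)
Definition decidable_on (A : Type) (code : A -> nat) (P Q : A -> Prop) : Prop :=
  exists f : recf 1, forall x, P x ->
    exists b : bool, eval f [tuple code x] b /\ (Q x <-> b).

Definition code_action n (a : action 'I_n) : nat :=
  match a with Stay => 0 | Pop => 1 | Push g => g.+2 end.

Definition code_entry n g1 g2
    (e : option ('I_n * action 'I_g1 * action 'I_g2)) : nat :=
  CodeSeq.code
    (if e is Some (q, a1, a2) then [:: q : nat; code_action a1; code_action a2]
     else [::]).

(* The sizes, the initial state, the characteristic sequence of the final     *)
(* states and the transition table, listed in lexicographic order.            *)
Definition code_dpda2 (M : dpda2) : nat :=
  CodeSeq.code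
    ([:: nstates M; nletters M; nsymbols1 M; nsymbols2 M; start M : nat]
       ++ [seq nat_of_bool (q \in final M) | q : 'I_(nstates M)]
       ++ [seq code_entry e | e <- codom (trans M)]).

Lemma code_action_inj n : injective (@code_action n).
Proof. by case=> [g||] [h||] //= [] /ord_inj ->. Qed.

Lemma code_entry_inj n g1 g2 : injective (@code_entry n g1 g2).
Proof.
move=> e e' /(can_inj CodeSeq.codeK).
case: e e' => [[[q a1] a2]|] [[[q' b1] b2]|] //= [].
by move=> /ord_inj -> /code_action_inj -> /code_action_inj ->.
Qed.

Lemma code_dpda2_inj : injective code_dpda2.
Proof.
move=> [n k g1 g2 q F d] [n' k' g1' g2' q' F' d'] /(can_inj CodeSeq.codeK) /=.
case=> en ek e1 e2; subst n' k' g1' g2' => /ord_inj <- /eqP.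
rewrite eqseq_cat ?size_map // => /andP[/eqP eF /eqP ed].
have -> : F = F'.
  apply/setP=> x; have /eq_in_map/(_ x) := eF.
  by rewrite mem_enum => /(_ isT); case: (x \in F); case: (x \in F').
suff -> : d = d' by [].
apply/ffunP=> x; have /(inj_map (@code_entry_inj _ _ _)) := ed.
by move=> /eq_in_map/(_ x); rewrite mem_enum => /(_ isT).
Qed.

(* Main.v *)
Require Import Defs.
From mathcomp Require Import all_boot zify.

(* The input letters of the automata below choose what is pushed on stack 1
   and stack 2, which thus come to hold two words u and v; when the pushing is
   over, surplus symbols are popped from stack 2 and the stacks are compared.
   If u is the sequence of symbols read and v the sequence of those written by
   a deterministic queue machine, then u is a prefix of v exactly when every
   symbol read was guessed correctly, so that some word is accepted iff the
   queue machine halts. A queue of unary numbers holds the registers of a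
   counter machine, so queue machines compute all recursive functions. Since
   the accepting state absorbs every continuation, the language is dense as
   soon as it is nonempty.

   Given a putative decision procedure f, a queue program p0 applies f to the
   code of the automaton running p0, and halts iff the answer is negative.
   Self-reference is easy because prepending a fixed list acts on codes of
   lists as an affine map x |-> a * x + b: the automaton consists of p0
   followed by a loader that writes a, b and the number of states of p0 in the
   queue, and its code is an elementary function of these three numbers. *)

Set Implicit Arguments.
Unset Strict Implicit.
Unset Printing Implicit Defensive.

(** * Computable functions *)

Definition computable n (F : n.-tuple nat -> nat) : Prop :=
  exists f : recf n, forall xs, eval f xs (F xs).

Lemma eq_computable n (F G : n.-tuple nat -> nat) :
  F =1 G -> computable F -> computable G.
Proof. by move=> eFG [f fP]; exists f => xs; rewrite -eFG. Qed.

Lemma computable_proj n (i : 'I_n) : computable (fun xs => tnth xs i).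
Proof. by exists (Proj i). Qed.

Lemma computable_comp m n (G : m.-tuple nat -> nat) (H : 'I_m -> n.-tuple nat -> nat) :
  computable G -> (forall i, computable (H i)) ->
  computable (fun xs => G [tuple H i xs | i < m]).
Proof.
move=> [g gP] /fin_all_exists[h hP]; exists (Comp g h) => xs.
by exists [tuple H i xs | i < m]; split=> // i; rewrite tnth_mktuple.
Qed.

Lemma computable_succ n (F : n.-tuple nat -> nat) :
  computable F -> computable (fun xs => (F xs).+1).
Proof.
move=> cF; have cS : computable (fun ys : 1.-tuple nat => (thead ys).+1).
  by exists Succ.
apply: eq_computable (computable_comp cS (fun=> cF)) => xs.
by rewrite /thead tnth_mktuple.
Qed.

Lemma computable_const n c : computable (fun _ : n.-tuple nat => c).
Proof.
elim: c => [|c IHc]; last exact: computable_succ IHc.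
have c0 : computable (fun _ : 0.-tuple nat => 0) by exists Zero.
by apply: eq_computable (@computable_comp 0 n _ (fun _ _ => 0) c0 _) => // -[].
Qed.

(** Primitive recursion with parameters. The arguments of the recursion step come in the order that
    [Prec] imposes: counter, previous value, parameters. *)
Lemma computable_iteri n (g : nat -> nat -> n.-tuple nat -> nat)
    (Z K : n.-tuple nat -> nat) :
  computable (fun ys : n.+2.-tuple nat =>
    g (thead ys) (thead (behead_tuple ys)) (behead_tuple (behead_tuple ys))) ->
  computable Z -> computable K ->
  computable (fun xs => iteri (K xs) (fun j v => g j v xs) (Z xs)).
Proof.
move=> [h hP] [z zP] [k kP].
exists (Comp (Prec z h) (fun i => oapp (@Proj n) k (unlift ord0 i))) => xs.
exists [tuple of K xs :: xs]; split=> [i|].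
  by case: unliftP => [j|] -> /=; rewrite ?tnth0 ?tnthS //; apply: kP.
have: behead_tuple [tuple of K xs :: xs] = xs by apply: val_inj.
have: thead [tuple of K xs :: xs] = K xs by rewrite theadE.
move: [tuple of K xs :: xs] => ys /= -> e.
elim: (K xs) => [|m IHm] /=; first by rewrite e; apply: zP.
exists (iteri m (fun j v => g j v xs) (Z xs)); split=> //.
set t := [tuple of m :: _]; suff <- : g (thead t) (thead (behead_tuple t))
    (behead_tuple (behead_tuple t)) = g m (iteri m (fun j v => g j v xs) (Z xs)) xs.
  exact: hP.
by congr g; rewrite -e; apply: val_inj.
Qed.

Lemma computable_head n : computable (fun xs : n.+1.-tuple nat => thead xs).
Proof. exact: computable_proj. Qed.

Lemma computable_behead n (F : n.-tuple nat -> nat) :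
  computable F -> computable (fun xs : n.+1.-tuple nat => F (behead_tuple xs)).
Proof.
move=> cF.
apply: eq_computable (computable_comp cF (fun i => computable_proj (lift ord0 i))).
move=> xs; congr F; apply: eq_from_tnth => i; rewrite tnth_mktuple tnth_behead.
by congr tnth; apply: val_inj; rewrite /= inordK // ltnS.
Qed.

Section Arithmetic.

Variables (n : nat) (F G : n.-tuple nat -> nat).
Hypotheses (cF : computable F) (cG : computable G).

Lemma computable_add : computable (fun xs => F xs + G xs).
Proof.
apply: eq_computable (computable_iteri (g := fun _ v _ => v.+1) _ cF cG).
  by move=> xs; elim: (G xs) => [|k IHk] /=; rewrite ?addn0 // IHk addnS.
exact/computable_succ/computable_behead/computable_head.
Qed.

Lemma computable_sub : computable (fun xs => F xs - G xs).
Proof.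
have cp m (H : m.-tuple nat -> nat) : computable H -> computable (fun xs => (H xs).-1).
  move=> cH; apply: eq_computable
    (computable_iteri (g := fun j _ _ => j) _ (computable_const m 0) cH).
    by move=> xs; case: (H xs).
  exact: computable_head.
apply: eq_computable (computable_iteri (g := fun _ v _ => v.-1) _ cF cG).
  by move=> xs; elim: (G xs) => [|k IHk] /=; rewrite ?subn0 // IHk subnS.
exact/cp/computable_behead/computable_head.
Qed.

End Arithmetic.

Lemma computable_mul n (F G : n.-tuple nat -> nat) :
  computable F -> computable G -> computable (fun xs => F xs * G xs).
Proof.
move=> cF cG; apply: eq_computable
  (computable_iteri (g := fun _ v xs => F xs + v) _ (computable_const n 0) cG).
  by move=> xs; elim: (G xs) => [|k IHk] /=; rewrite ?muln0 // IHk mulnS.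
apply: computable_add; first exact: computable_behead (computable_behead cF).
exact/computable_behead/computable_head.
Qed.

Lemma computable_exp n (F G : n.-tuple nat -> nat) :
  computable F -> computable G -> computable (fun xs => F xs ^ G xs).
Proof.
move=> cF cG; apply: eq_computable
  (computable_iteri (g := fun _ v xs => F xs * v) _ (computable_const n 1) cG).
  by move=> xs; elim: (G xs) => [|k IHk] /=; rewrite ?expn0 // IHk expnS.
apply: computable_mul; first exact: computable_behead (computable_behead cF).
exact/computable_behead/computable_head.
Qed.

(** The recursive step of [CodeSeq.code]. *)
Definition code_cons x c := 2 ^ x * c.*2.+1.

Lemma computable_code_cons n (F G : n.-tuple nat -> nat) :
  computable F -> computable G -> computable (fun xs => code_cons (F xs) (G xs)).
Proof.
move=> cF cG; apply: computable_mul.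
  exact/computable_exp/cF/computable_const.
apply/computable_succ; apply: eq_computable (computable_add cG cG) => xs.
by rewrite addnn.
Qed.

(** * Counter programs *)
(** [Loop r P] decrements [r] before each pass and [P] may increase it again, so this is a while
    loop, able to express unbounded search. *)
Inductive prog : Type :=
| Skip
| Inc of nat
| Seq of prog & prog
| Loop of nat & prog.

Definition upd (s : nat -> nat) r x : nat -> nat := fun i => if i == r then x else s i.

Inductive exec : prog -> (nat -> nat) -> (nat -> nat) -> Prop :=
| ExecSkip s : exec Skip s s
| ExecInc r s : exec (Inc r) s (upd s r (s r).+1)
| ExecSeq P Q s t u : exec P s t -> exec Q t u -> exec (Seq P Q) s u
| ExecLoop0 r P s : s r = 0 -> exec (Loop r P) s s
| ExecLoopS r P s t u x : s r = x.+1 -> exec P (upd s r x) t ->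
    exec (Loop r P) t u -> exec (Loop r P) s u.

Definition wp P s (Q : (nat -> nat) -> Prop) := exists2 t, exec P s t & Q t.

Lemma wp_conseq P s (Q R : (nat -> nat) -> Prop) :
  wp P s Q -> (forall t, Q t -> R t) -> wp P s R.
Proof. by move=> [t ? ?] QR; exists t; last apply: QR. Qed.

Lemma wp_skip s (Q : (nat -> nat) -> Prop) : Q s -> wp Skip s Q.
Proof. by exists s => //; constructor. Qed.

Lemma wp_inc r s (Q : (nat -> nat) -> Prop) :
  Q (upd s r (s r).+1) -> wp (Inc r) s Q.
Proof. by move=> ?; exists (upd s r (s r).+1) => //; constructor. Qed.

Lemma wp_seq P P' s Q : wp P s (fun t => wp P' t Q) -> wp (Seq P P') s Q.
Proof. by move=> [t st [u tu ?]]; exists u => //; apply: ExecSeq tu. Qed.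

(* The invariant is indexed by the number of iterations still to be run.      *)
Lemma wp_loop r P (I : nat -> (nat -> nat) -> Prop) k s :
  (forall t, I 0 t -> t r = 0) ->
  (forall j t, I j.+1 t -> exists2 x, t r = x.+1 & wp P (upd t r x) (I j)) ->
  I k s -> wp (Loop r P) s (I 0).
Proof.
move=> I0 IS; elim: k s => [|k IHk] s Is.
  by exists s => //; apply: ExecLoop0; apply: I0.
have [x sr [t xt /IHk[u tu Iu]]] := IS _ _ Is.
by exists u => //; apply: ExecLoopS tu; eassumption.
Qed.

(** * Compiling recursive functions to counter programs *)

Definition clear r := Loop r Skip.

Lemma wp_clear r s :
  wp (clear r) s (fun t => t r = 0 /\ forall i, i != r -> t i = s i).
Proof.
apply: (@wp_loop _ _ (fun k t => t r = k /\ forall i, i != r -> t i = s i) (s r))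
  => // [t []|j t [tr ti]] //.
exists j => //; apply: wp_skip; rewrite /upd eqxx; split=> // i ir.
by rewrite (negPf ir) ti.
Qed.

(** The only test of a register decrements it, so [x] is emptied into the scratch register [t], from
    which [x] and [y] are rebuilt together. *)
Definition copy x y t :=
  Seq (clear y) (Seq (clear t)
    (Seq (Loop x (Inc t)) (Loop t (Seq (Inc x) (Inc y))))).

Lemma wp_copy x y t s : x != y -> x != t -> y != t ->
  wp (copy x y t) s
    (fun s' => s' y = s x /\ forall i, i != y -> i != t -> s' i = s i).
Proof.
move=> xy xt yt; have [yx tx ty] : [/\ y != x, t != x & t != y].
  by rewrite ![_ == x]eq_sym [t == y]eq_sym.
apply/wp_seq/(wp_conseq (wp_clear y s)) => s1 [s1y s1i].
apply/wp_seq/(wp_conseq (wp_clear t s1)) => s2 [s2t s2i].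
pose I1 k s' := [/\ s' x = k, s' x + s' t = s x, s' y = 0 &
  forall i, i != x -> i != y -> i != t -> s' i = s i].
pose I2 k s' := [/\ s' t = k, s' x + s' t = s x, s' y = s' x &
  forall i, i != x -> i != y -> i != t -> s' i = s i].
apply/wp_seq/(@wp_conseq _ _ (I1 0)) => [|u [ux ut uy ui]].
  apply: (@wp_loop _ _ I1 (s x)) => [u []|j u [ux ut uy ui]|] //.
    exists j => //; apply/wp_inc; rewrite /I1 /upd eqxx.
    rewrite !(negPf xt) !(negPf tx) (negPf yt) (negPf yx) uy eqxx.
    split=> // [|i ix iy it]; first by lia.
    by rewrite (negPf it) (negPf ix) ui.
  split=> [||| i ix iy it]; first by rewrite s2i // s1i.
  - by rewrite s2t s2i // s1i // addn0.
  - by rewrite s2i.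
  by rewrite s2i // s1i.
apply: (@wp_conseq _ _ (I2 0)) => [|v [vt vx vy vi]].
  apply: (@wp_loop _ _ I2 (s x)) => [v []|j v [vt vx vy vi]|] //.
    exists j => //; apply/wp_seq/wp_inc/wp_inc; rewrite /I2 /upd !eqxx.
    rewrite !(negPf xt) !(negPf tx) !(negPf ty) !(negPf yt) !(negPf yx) !(negPf xy).
    split=> // [|| i ix iy it]; rewrite ?vy //; first by lia.
    by rewrite (negPf it) (negPf ix) (negPf iy) vi.
  by split=> //; [lia | rewrite ux ].
split=> [|i iy it]; first by lia.
by have [->|ix] := eqVneq i x; [lia | apply: vi].
Qed.

(** Argument [i] sits in register [a i], the result goes to [b], and the registers above [b] are
    scratch. For [Prec], [b.+1] counts the passes left, [b.+2] is the index and [b.+3] the current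
    value; for [Mu], [b] is the candidate and [b.+1] the value of [f] at it. *)
Fixpoint gen n (f : recf n) : (nat -> nat) -> nat -> prog :=
  match f with
  | Zero => fun _ b => clear b
  | Succ => fun a b => Seq (copy (a 0) b b.+1) (Inc b)
  | Proj _ i => fun a b => copy (a i) b b.+1
  | Comp m _ f g => fun a b =>
      Seq (foldr (fun i P => Seq (gen (g i) a (b.+1 + i)) P) Skip (enum 'I_m))
        (Seq (gen f (fun i => b.+1 + i) (b.+1 + m))
             (copy (b.+1 + m) b (b.+2 + m)))
  | Prec _ f g => fun a b =>
      Seq (copy (a 0) b.+1 b.+2)
        (Seq (clear b.+2)
          (Seq (gen f (fun i => a i.+1) b.+3)
            (Seq (Loop b.+1
                   (Seq (gen g (fun i => match i with
                                         | 0 => b.+2 | 1 => b.+3 | j.+2 => a j.+1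
                                         end) b.+4)
                     (Seq (copy b.+4 b.+3 b.+4.+1) (Inc b.+2))))
              (copy b.+3 b b.+4))))
  | Mu _ f => fun a b =>
      let P := gen f (fun i => if i is j.+1 then a j else b) b.+1 in
      Seq (clear b) (Seq P (Loop b.+1 (Seq (Inc b) P)))
  end.

(** Preservation of the registers below [b] makes the inductive calls compose: each receives a
    larger [b], above all live registers. *)
Lemma wp_gen n (f : recf n) (a : nat -> nat) b (xs : n.-tuple nat) y s :
  eval f xs y -> (forall i, i < n -> a i < b) ->
  (forall i, i < n -> s (a i) = nth 0 xs i) ->
  wp (gen f a b) s (fun t => t b = y /\ forall i, i < b -> t i = s i).
Proof.
elim: f a b xs y s => {n}
  [||n j|m n f IHf g IHg|n f IHf g IHg|n f IHf] a b xs y s /= ev ab sa.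
- apply: (wp_conseq (wp_clear b s)) => t [tb ti]; split=> [|i ib]; first by rewrite ev.
  by apply: ti; lia.
- have a0 := ab 0 isT; have {}sa := sa 0 isT.
  apply/wp_seq; apply: wp_conseq (@wp_copy (a 0) b b.+1 s _ _ _) _; try lia.
  move=> t [tb ti]; apply/wp_inc; rewrite /upd eqxx; split.
    by rewrite tb sa ev /thead (tnth_nth 0).
  by move=> i ib; rewrite ifN ?ti //; lia.
- have aj := ab j (ltn_ord j).
  apply: wp_conseq (@wp_copy (a j) b b.+1 s _ _ _) _; try lia.
  move=> t [tb ti]; split=> [|i ib]; first by rewrite tb sa // ev (tnth_nth 0).
  by apply: ti; lia.
- have [zs [gzs fzs]] := ev; apply/wp_seq.
  apply: (@wp_conseq _ _ (fun t => (forall i : 'I_m, i \in enum 'I_m ->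
    t (b.+1 + i) = tnth zs i) /\ forall i, i < b.+1 -> t i = s i)); last first.
    move=> t [tz ti]; apply/wp_seq.
    apply: wp_conseq (IHf _ _ _ _ _ fzs _ _) _.
    + by move=> i im; lia.
    + move=> i im; rewrite (tz (Ordinal im)) ?mem_enum //.
      by rewrite (tnth_nth 0).
    move=> u [ub ui]; apply: wp_conseq (@wp_copy (b.+1 + m) b (b.+2 + m) u _ _ _) _;
      try lia.
    move=> v [vb vi]; split=> [|i ib]; first by rewrite vb.
    by rewrite vi ?ui ?ti //; lia.
  have pl: sorted ltn (map val (enum 'I_m)) by rewrite val_enum_ord iota_ltn_sorted.
  have sa1 i : i < n -> a i < b.+1 by move/ab; lia.
  (* Generalised for induction on the list: as [enum 'I_m] is increasing, later components only
     touch registers above the results already stored. *)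
  apply: (@wp_conseq _ _ (fun t => (forall i : 'I_m, i \in enum 'I_m ->
    t (b.+1 + i) = tnth zs i) /\
    forall j, all (fun i : 'I_m => j < b.+1 + i) (enum 'I_m) -> t j = s j)); last first.
    by move=> t [tz ti]; split=> // i ib; apply: ti; apply/allP => j _; lia.
  elim: (enum 'I_m) s sa pl => [|i l IHl] s sa pl /=.
    by apply: wp_skip; split=> // j; rewrite in_nil.
  apply/wp_seq/(wp_conseq (IHg i a (b.+1 + i) _ _ s (gzs i) _ sa)).
    by move=> j /ab; lia.
  move=> t [tb tj]; apply: wp_conseq (IHl t _ (path_sorted pl)) _.
    by move=> j jn; rewrite tj ?sa //; have := ab j jn; lia.
  move=> u [uz uj]; split=> [k|j /andP[ji jl]]; last by rewrite uj ?tj.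
  rewrite inE => /predU1P[->|/uz] //; rewrite uj //.
  apply/allP => k' k'l.
  by have /allP/(_ k' (map_f val k'l)) := order_path_min ltn_trans pl; rewrite /=; lia.
- have a0 := ab 0 isT; have sa0 := sa 0 isT.
  move: ev; set rec := (X in X (thead xs) y).
  rewrite /thead (tnth_nth 0) -sa0 => ev.
  have xsE i : nth 0 xs i.+1 = nth 0 (behead_tuple xs) i by rewrite nth_behead.
  apply/wp_seq/(wp_conseq (@wp_copy (a 0) b.+1 b.+2 s _ _ _)); try lia.
  move=> s1 [s1b s1i]; apply/wp_seq/(wp_conseq (wp_clear b.+2 s1)) => s2 [s2b s2i].
  have {s2b s2i} [s2K s2I s2i] : [/\ s2 b.+1 = s (a 0), s2 b.+2 = 0
      & forall i, i <= b -> s2 i = s i].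
    by split=> // [|i ib]; rewrite s2i ?s1b // ?s1i //; lia.
  (* The nested existentials of [rec] are gathered into one sequence [u] of intermediate values. *)
  have {ev} [u [u0 uS uy]] : exists u : nat -> nat, [/\ eval f (behead_tuple xs) (u 0),
      forall k, k < s (a 0) -> eval g [tuple of k :: u k :: behead_tuple xs] (u k.+1)
      & u (s (a 0)) = y].
    elim: (s (a 0)) y ev => [|k IHk] y ev; first by exists (fun=> y).
    case: ev => v [rv gv]; have [u [u0 uS uv]] := IHk v rv.
    exists (fun i => if i == k.+1 then y else u i); rewrite eqxx; split=> // i.
    rewrite ltnS eqSS leq_eqVlt => /predU1P[->|ik]; first by rewrite eqxx ltn_eqF // uv.
    have [-> ->] : (i == k.+1) = false /\ (i == k) = false by lia.
    exact: uS.
  apply/wp_seq/(wp_conseq (IHf _ b.+3 _ _ s2 u0 _ _)) => [i i_n|i i_n|].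
  + by rewrite (leq_trans (ab i.+1 i_n)) //; lia.
  + by rewrite s2i ?sa ?xsE // ltnW // ab.
  move=> s3 [s3V s3i]; apply/wp_seq.
  pose I k t := [/\ k <= s (a 0), t b.+1 = k, t b.+2 = s (a 0) - k,
    t b.+3 = u (s (a 0) - k) & forall i, i <= b -> t i = s i].
  apply: (@wp_conseq _ _ (I 0)) => [|t [_ tK tI tV ti]]; last first.
    apply: wp_conseq (@wp_copy b.+3 b b.+4 t _ _ _) _; try lia.
    move=> v [vb vi]; split=> [|i ib]; first by rewrite vb tV subn0.
    by rewrite vi ?ti //; lia.
  apply: (@wp_loop _ _ I (s (a 0))) => [t []|k t [ka tK tI tV ti]|] //; last first.
    split=> [|||| i ib]; rewrite ?subnn //; first by rewrite s3i // s2K.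
      by rewrite s3i.
    by rewrite s3i ?s2i //; lia.
  exists k => //; apply/wp_seq; set t' := upd _ _ _.
  have [t'K t'I t'V t'i] : [/\ t' b.+1 = k, t' b.+2 = t b.+2, t' b.+3 = t b.+3
      & forall i, i <= b -> t' i = s i].
    by rewrite /t' /upd eqxx; split=> // [||i ib]; rewrite ifN //; try lia; exact: ti.
  apply: wp_conseq (IHg _ b.+4 _ _ t' (uS (s (a 0) - k.+1) _) _ _) _.
  - by lia.
  - by case=> [|[|i]] // i_n; rewrite (leq_trans (ab i.+1 i_n)) //; lia.
  - case=> [|[|i]] i_n; rewrite ?t'I ?t'V // t'i ?sa ?xsE //.
    by rewrite ltnW // ab.
  move=> v [vb vi]; apply/wp_seq.
  apply: wp_conseq (@wp_copy b.+4 b.+3 b.+1.+4 v _ _ _) _; try lia.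
  move=> w [wV wi]; apply: wp_inc; rewrite /I /upd eqxx !ifN; try lia.
  rewrite wV vb -subSn // subSS; split=> // [|||i ib]; first by lia.
  - by rewrite wi ?vi ?t'K //; lia.
  - by rewrite wi ?vi ?t'I //; lia.
  - by rewrite ifN ?wi ?vi ?t'i //; lia.
- have [e0 e1] := ev.
  pose a' i := if i is j.+1 then a j else b; rewrite -/a'; set Q := gen f a' b.+1.
  have ab' i : i < n.+1 -> a' i < b.+1 by case: i => [|i] //= /ab; lia.
  have sa' t j : t b = j -> (forall i, i < b -> t i = s i) ->
      forall i, i < n.+1 -> t (a' i) = nth 0 [tuple of j :: xs] i.
    by move=> tb ti [|i] //= i_n; rewrite ti ?sa // ab.
  have ex j : j <= y -> exists2 v, eval f [tuple of j :: xs] v & (v == 0) = (j == y).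
    rewrite leq_eqVlt => /predU1P[->|jy]; first by exists 0; rewrite ?eqxx.
    by have [v ev1] := e1 j jy; exists v.+1; [exact: ev1 | rewrite (ltn_eqF jy)].
  pose I k t := [/\ k <= y, t b = y - k, (t b.+1 == 0) = (k == 0)
    & forall i, i < b -> t i = s i].
  have wpQ k t : k <= y -> t b = y - k -> (forall i, i < b -> t i = s i) -> wp Q t (I k).
    move=> ky tb ti; have [v ev1 v0] := ex (y - k) (leq_subr _ _).
    apply: wp_conseq (IHf _ _ _ _ _ ev1 ab' (sa' t _ tb ti)) _ => u [ub ui].
    split=> // [||i ib]; first by rewrite ui.
      by rewrite ub v0; lia.
    by rewrite ui ?ti //; lia.
  apply/wp_seq/(wp_conseq (wp_clear b s)) => t [tb ti]; apply/wp_seq.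
  apply: (@wp_conseq _ _ (I y)).
    by apply: wpQ; rewrite ?subnn // => i ib; apply: ti; lia.
  move=> u Iu; apply: (@wp_conseq _ _ (I 0)) => [|v [_ vb _ vi]]; last first.
    by rewrite vb subn0.
  apply: wp_loop Iu => [v [_ _ ]|k v [ky vb v0 vi]]; first by rewrite eqxx => /eqP.
  (* The decremented value in [b.+1] is overwritten by the next run of [Q]. *)
  case: (v b.+1) v0 => // x _; exists x => //; apply/wp_seq/wp_inc/wpQ; first by lia.
    by rewrite /upd eqxx ifN ?vb //; lia.
  by move=> i ib; rewrite /upd !ifN ?vi //; lia.
Qed.

(** * Queue programs *)

Notation sharp := (ord0 : 'I_2).
Notation stroke := (ord_max : 'I_2).

(** [Write None r] is a plain jump; [Read] has one target for a stroke and one for a sharp, in this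
    order. *)
Inductive instr : Type :=
| Write of option 'I_2 & nat
| Read of nat & nat.

(* States 0, 1 and 2 are reserved for the final phase of the automaton.        *)
Definition fetch (p : seq instr) q := if q is q'.+3 then onth p q' else None.

Definition qstep p (c : nat * seq 'I_2) : option (nat * seq 'I_2) :=
  match fetch p c.1, c.2 with
  | Some (Write o r), l => Some (r, oapp (rcons l) l o)
  | Some (Read r1 r0), a :: l => Some (if a == sharp then r0 else r1, l)
  | _, _ => None
  end.

Inductive reach p : nat * seq 'I_2 -> nat * seq 'I_2 -> Prop :=
| ReachRefl c : reach p c c
| ReachStep c d e : qstep p c = Some d -> reach p d e -> reach p c e.

Lemma reach_trans p c d e : reach p c d -> reach p d e -> reach p c e.
Proof. by move=> cd; elim: cd => // {}c x {}d cx _ IH /IH; apply: ReachStep. Qed.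

Lemma reach_write p q o r l e : fetch p q = Some (Write o r) ->
  reach p (r, oapp (rcons l) l o) e -> reach p (q, l) e.
Proof. by move=> pq; apply: ReachStep; rewrite /qstep pq. Qed.

Lemma reach_read p q r1 r0 a l e : fetch p q = Some (Read r1 r0) ->
  reach p (if a == sharp then r0 else r1, l) e -> reach p (q, a :: l) e.
Proof. by move=> pq; apply: ReachStep; rewrite /qstep pq. Qed.

Definition code_at p off c := forall i, i < size c -> fetch p (off + i) = onth c i.

Lemma code_at_cat p off c d :
  code_at p off (c ++ d) <-> code_at p off c /\ code_at p (off + size c) d.
Proof.
split=> [pcd|[pc pd] i].
  split=> i ic; first by rewrite pcd ?size_cat ?onth_cat ?ic // ltn_addr.
  by rewrite -addnA pcd ?size_cat ?ltn_add2l // onth_cat ltnNge leq_addr addKn.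
rewrite size_cat onth_cat; case: (ltnP i (size c)) => [ic _|ci icd]; first exact: pc.
by rewrite -pd -?addnA ?subnKC // ltn_subLR.
Qed.

Lemma code_at_cons p off x c :
  code_at p off (x :: c) <-> fetch p off = Some x /\ code_at p off.+1 c.
Proof.
rewrite -cat1s code_at_cat addn1; split=> -[px pc]; split=> //.
  by rewrite -[off]addn0 px.
by case=> //; rewrite addn0.
Qed.

Definition enc (s : seq nat) : seq 'I_2 :=
  flatten [seq rcons (nseq x stroke) sharp | x <- s].

Arguments enc : simpl never.

Lemma enc_cons x s : enc (x :: s) = rcons (nseq x stroke) sharp ++ enc s.
Proof. by []. Qed.

Lemma enc_cat s t : enc (s ++ t) = enc s ++ enc t.
Proof. by rewrite /enc map_cat flatten_cat. Qed.

(** Only the front of a queue can be inspected, so a register is reached by moving the preceding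
    blocks to the rear, one [rotate] each. *)
Definition rotate off :=
  [:: Read off.+1 off.+2; Write (Some stroke) off; Write (Some sharp) off.+3].

Fixpoint rotates j off :=
  if j is j'.+1 then rotate off ++ rotates j' off.+3 else [::].

Lemma size_rotates j off : size (rotates j off) = 3 * j.
Proof. by elim: j off => //= j IHj off; rewrite IHj; lia. Qed.

Lemma reach_rotate p off x l : code_at p off (rotate off) ->
  reach p (off, rcons (nseq x stroke) sharp ++ l)
          (off.+3, l ++ rcons (nseq x stroke) sharp).
Proof.
move=> /code_at_cons[p0 /code_at_cons[p1 /code_at_cons[p2 _]]].
elim: x l => [|x IHx] l /=; apply: (reach_read p0) => /=.
  by apply: (reach_write p2); rewrite /= cats1; constructor.
apply: (reach_write p1) => /=; rewrite -cat_rcons rcons_cat; exact: IHx.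
Qed.

Lemma reach_rotates p off s l : code_at p off (rotates (size s) off) ->
  reach p (off, enc s ++ l) (off + 3 * size s, l ++ enc s).
Proof.
elim: s off l => [|x s IHs] off l.
  by rewrite muln0 addn0 cats0; constructor.
rewrite /= -[[:: _, _, _ & _]]/(rotate off ++ _) => /code_at_cat[pr ps].
rewrite enc_cons -catA; apply: reach_trans (reach_rotate _ _ pr) _.
have -> : off + 3 * (size s).+1 = off.+3 + 3 * size s by lia.
by rewrite -catA (catA l); apply: IHs; move: ps; rewrite addn3.
Qed.

(** The queue holds [k] blocks, and [r] rotations bring that of register [r] to the front. [Inc]
    writes a stroke at the rear, where it becomes the first symbol of this block once the block is
    rotated there in turn. [Loop] removes the first symbol of the block: a stroke means that [r] was
    positive and is now decremented, a sharp that [r] was zero, and the sharp is then put back at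
    the rear. The remaining rotations restore the order. *)
Fixpoint qcomp k P off : seq instr :=
  match P with
  | Skip => [::]
  | Inc r =>
      let h := off + 3 * r in
      rotates r off ++ Write (Some stroke) h.+1 :: rotates (k - r) h.+1
  | Seq P Q => let c := qcomp k P off in c ++ qcomp k Q (off + size c)
  | Loop r P =>
      let h := off + 3 * r in
      let b := h.+1 + 3 * (k - r) in
      let c := qcomp k P b in
      let x := b + size c in
      rotates r off ++ Read h.+1 x.+1 :: rotates (k - r) h.+1 ++ c ++
        [:: Write None off, Write (Some sharp) x.+2 & rotates (k - r.+1) x.+2]
  end.

Fixpoint bound P : nat :=
  match P with
  | Skip => 0
  | Inc r => r.+1
  | Seq P Q => maxn (bound P) (bound Q)
  | Loop r P => maxn r.+1 (bound P)
  end.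

Lemma mkseq_upd s r x k : r < k ->
  mkseq (upd s r x) k = mkseq s r ++ x :: map s (iota r.+1 (k - r.+1)).
Proof.
move=> rk; have {1}-> : k = r + (k - r.+1).+1 by lia.
rewrite /mkseq iotaD map_cat /= {2}/upd eqxx; congr (_ ++ _ :: _).
  by apply/eq_in_map=> i; rewrite mem_iota /upd => /andP[_ ir]; rewrite ltn_eqF.
by apply/eq_in_map=> i; rewrite mem_iota /upd => /andP[ri _]; rewrite gtn_eqF.
Qed.

Lemma mkseq_split (s : nat -> nat) r k : r < k ->
  mkseq s k = mkseq s r ++ s r :: map s (iota r.+1 (k - r.+1)).
Proof.
move=> rk; rewrite -mkseq_upd //; apply/eq_mkseq => i.
by rewrite /upd; case: eqP => [->|].
Qed.

(** Induction on the execution, not on the program: a further pass of a loop reenters the same code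
    at the same offset. *)
Lemma reach_qcomp p k P off s t : exec P s t -> bound P <= k ->
  code_at p off (qcomp k P off) ->
  reach p (off, enc (mkseq s k)) (off + size (qcomp k P off), enc (mkseq t k)).
Proof.
move=> st; elim: st off => {P s t}
  [s|r s|P Q s t u _ IHP _ IHQ|r P s sr|r P s t u x sr _ IHP _ IHL] off /=.
- by move=> _ _; rewrite addn0; constructor.
- move=> rk /code_at_cat[pr]; rewrite size_rotates => /code_at_cons[pw pr'].
  rewrite (mkseq_split s rk) mkseq_upd //.
  set A := mkseq s r; set B := [seq s i | i <- _].
  have sA : size A = r by rewrite size_mkseq.
  have sB y : size (y :: B) = k - r by rewrite /= size_map size_iota; lia.
  rewrite enc_cat; apply: (@reach_trans _ _ (off + 3 * r, enc (s r :: B) ++ enc A)).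
    by rewrite -[X in 3 * X]sA; apply: reach_rotates; rewrite sA.
  apply: (reach_write pw) => /=; rewrite rcons_cat.
  have := @reach_rotates p (off + 3 * r).+1 (s r :: B) (rcons (enc A) stroke).
  rewrite sB => /(_ pr'); rewrite size_cat /= !size_rotates enc_cat cat_rcons.
  by congr (reach _ _ (_, _)); lia.
- rewrite geq_max => /andP[bP bQ] /code_at_cat[pP pQ].
  apply: reach_trans (IHP _ bP pP) _; rewrite size_cat addnA; exact: IHQ.
- rewrite geq_max => /andP[rk bP] /code_at_cat[pr].
  rewrite size_rotates => /code_at_cons[pR /code_at_cat[_ /code_at_cat[_]]].
  rewrite size_rotates => /code_at_cons[_ /code_at_cons[pW pr']].
  rewrite (mkseq_split s rk) sr.
  set A := mkseq s r; set B := [seq s i | i <- _].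
  have sA : size A = r by rewrite size_mkseq.
  have sB : size B = k - r.+1 by rewrite size_map size_iota; lia.
  rewrite enc_cat; apply: (@reach_trans _ _ (off + 3 * r, enc (0 :: B) ++ enc A)).
    by rewrite -[X in 3 * X]sA; apply: reach_rotates; rewrite sA.
  rewrite enc_cons; apply: (reach_read pR) => /=; apply: (reach_write pW) => /=.
  rewrite rcons_cat.
  have := @reach_rotates p _ B (rcons (enc A) sharp).
  rewrite /= sB => /(_ _ pr'); rewrite !(size_cat, size_rotates) /= cat_rcons.
  rewrite !(size_cat, size_rotates) /= size_rotates.
  by congr (reach _ _ (_, _)); lia.
- rewrite geq_max => /andP[rk bP] pL.
  have /code_at_cat[pr] := pL; rewrite size_rotates.
  move=> /code_at_cons[pR /code_at_cat[pr' /code_at_cat[pP]]].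
  rewrite !size_rotates in pP * => /code_at_cons[pJ _].
  rewrite (mkseq_split s rk) sr.
  set A := mkseq s r; set B := [seq s i | i <- _].
  have sA : size A = r by rewrite size_mkseq.
  have sB y : size (y :: B) = k - r by rewrite /= size_map size_iota; lia.
  rewrite enc_cat; apply: (@reach_trans _ _ (off + 3 * r, enc (x.+1 :: B) ++ enc A)).
    by rewrite -[X in 3 * X]sA; apply: reach_rotates; rewrite sA.
  rewrite enc_cons; apply: (reach_read pR) => /=.
  have := @reach_rotates p _ (x :: B) (enc A).
  rewrite sB => /(_ _ pr'); rewrite -(enc_cat A) -[A ++ _](mkseq_upd s x rk).
  move=> /reach_trans; apply; apply: reach_trans (IHP _ bP pP) _.
  apply: (reach_write pJ) => /=; apply: IHL => //=.
  by rewrite geq_max rk.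
Qed.

Definition targets i :=
  match i with Write _ r => [:: r] | Read r1 r0 => [:: r1; r0] end.

(** Jumps to state 0 are excluded because it accepts everything: it must be entered only after the
    stacks have been compared. *)
Definition wf n i := all (fun r => 0 < r < n) (targets i).

Lemma wf_rotates n j off : 0 < off -> off + 3 * j < n -> all (wf n) (rotates j off).
Proof.
elim: j off => //= j IHj off off0 offn.
by rewrite IHj /wf /= ?andbT; lia.
Qed.

Lemma wf_qcomp n k P off : 0 < off -> off + size (qcomp k P off) < n ->
  all (wf n) (qcomp k P off).
Proof.
elim: P off => [|r|P IHP Q IHQ|r P IHP] off //= off0;
  rewrite ?(size_cat, size_rotates) /= ?size_rotates.
- by move=> h; rewrite all_cat /= !wf_rotates /wf /= ?andbT; lia.
- by move=> h; rewrite all_cat IHP ?IHQ //; lia.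
rewrite !(size_cat, size_rotates) /= !size_rotates => h.
rewrite !(all_cat, wf_rotates) /= ?all_cat ?IHP /= ?wf_rotates /wf /= ?andbT //; lia.
Qed.

(** * From queue programs to automata *)

Definition entry p q (a : 'I_2) (t1 t2 : option 'I_2) :
    option (nat * action 'I_2 * action 'I_2) :=
  match q with
  | 0 => Some (0, Stay, Stay)
  | 1 => Some (if a == sharp then (1, Stay, Pop) else (2, Stay, Stay))
  | 2 => match t1, t2 with
         | None, None => Some (0, Stay, Stay)
         | Some g, Some h => if g == h then Some (2, Pop, Pop) else None
         | _, _ => None
         end
  | _ => match fetch p q with
         | Some (Write o r) => Some (r, Stay, oapp (@Push _) Stay o)
         | Some (Read r1 r0) => Some (if a == sharp then r0 else r1, Push a, Stay)
         | None => None
         end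
  end.

(* Stack 1 records the symbols read from the queue, and stack 2 those written *)
(* to it. The input letter in a [Read] state is a guess of the symbol read.   *)
(* In state 1 the unread symbols are popped from stack 2; in state 2 the      *)
(* guesses are verified; state 0 accepts every continuation.                  *)
Definition automaton p q0 : dpda2 :=
  @Dpda2 (size p).+3 2 2 2 (inord q0) [set ord0]
    [ffun x : 'I_(size p).+3 * 'I_2 * option 'I_2 * option 'I_2 =>
       let: (q, a, t1, t2) := x in
       omap (fun e => (inord e.1.1, e.1.2, e.2)) (entry p q a t1 t2)].

(** Acceptance with plain numbers as states, which keeps [inord] out of the simulation arguments;
    [lang_automaton] makes the link. *)
Fixpoint accepts p q s1 s2 (w : seq 'I_2) : bool :=
  if w is a :: w' then
    if entry p q a (ohead s1) (ohead s2) is Some (q', a1, a2) then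
      if (act a1 s1, act a2 s2) is (Some s1', Some s2') then
        accepts p q' s1' s2' w'
      else false
    else false
  else q == 0.

Lemma all_onth T (a : pred T) (s : seq T) i x : all a s -> onth s i = Some x -> a x.
Proof.
by elim: s i => [|y s IHs] [|i] //= /andP[ay sa]; [case=> <- | apply: IHs].
Qed.

Lemma fetch_wf p q i : all (wf (size p).+3) p -> fetch p q = Some i ->
  wf (size p).+3 i.
Proof. by case: q => [|[|[|q]]] //=; apply: all_onth. Qed.

Lemma entry_in_range p q a t1 t2 q' a1 a2 : all (wf (size p).+3) p ->
  entry p q a t1 t2 = Some (q', a1, a2) -> q' < (size p).+3.
Proof.
move=> pwf; case: q => [|[|[|q]]] /=; first by case=> <-.
- by case: ifP => _ [<-].
- by case: t1 t2 => [g|] [h|] //; [case: ifP => // _ [<-] | case=> <-].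
case e: (onth p q) => [i|] //.
have := all_onth pwf e; case: i {e} => [o r|r1 r0] /=.
  by rewrite /wf /= andbT => /andP[_ ?] [<-].
by rewrite /wf /= andbT => /andP[/andP[_ ?] /andP[_ ?]] [<-]; case: ifP.
Qed.

Lemma lang_automaton p q0 w : all (wf (size p).+3) p -> q0 < (size p).+3 ->
  @lang (automaton p q0) w <-> accepts p q0 [::] [::] w.
Proof.
move=> pwf.
suff run_accepts q s1 s2 : q < (size p).+3 ->
    (exists ms (c : config (automaton p q0)),
       @run (automaton p q0) (inord q, s1, s2) w = Some (ms, c) /\
       c.1.1 \in final (automaton p q0)) <-> accepts p q s1 s2 w.
  exact: run_accepts.
elim: w q s1 s2 => [|a w IHw] q s1 s2 qn /=.
  have <- : ((inord q : 'I_(size p).+3) \in [set ord0]) = (q == 0).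
    by rewrite inE -val_eqE /= inordK.
  by split=> [[ms [c [[_ <-]]]]|q0f] //; exists [::]; eexists; split.
rewrite ffunE /= inordK //.
case e: (entry _ _ _ _ _) => [[[q' a1] a2]|] /=; last by split=> // -[ms [c []]].
case: (act a1 s1) => [s1'|]; last by split=> // -[ms [c []]].
case: (act a2 s2) => [s2'|]; last by split=> // -[ms [c []]].
rewrite -(IHw q' _ _ (entry_in_range pwf e)); split=> -[ms [c [rw cf]]].
  by move: rw; case: run => // -[ms' c'] [_ cc']; exists ms', c'; rewrite cc'.
by exists ((a1, a2) :: ms), c; rewrite rw.
Qed.

Lemma accepts_cat p q s1 s2 w y : accepts p q s1 s2 w -> accepts p q s1 s2 (w ++ y).
Proof.
elim: w q s1 s2 => [|a w IHw] q s1 s2 /=; last first.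
  case: entry => // -[[q' a1] a2]; case: act => // s1'; case: act => // s2'.
  exact: IHw.
by move/eqP->; elim: y.
Qed.

Lemma dense_automaton p q0 : all (wf (size p).+3) p -> q0 < (size p).+3 ->
  dense (@lang (automaton p q0)) <-> exists w, accepts p q0 [::] [::] w.
Proof.
move=> pwf q0n; split=> [/(_ [::])[x [z]]|[w aw] y].
  by rewrite cat0s => Lxz; exists (x ++ z); apply/(lang_automaton _ pwf q0n).
exists w, [::]; apply/(lang_automaton _ pwf q0n).
exact: accepts_cat.
Qed.

(** Invariant for the rest of a run on one stack: [b] tells whether the pushing phase may still be
    going on. *)
Definition phased b (d : seq bool) :=
  exists k l, d = nseq (if b then k else 0) true ++ nseq l false.

Lemma reversals_phased G (s : seq (action G)) b :
  phased b (pmap (@direction G) s) -> reversals s <= 1.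
Proof.
have nrev b' j : pairmap addb b' (nseq j b') = nseq j false.
  by elim: j => //= j ->; rewrite addbb.
rewrite /reversals; case=> k [l ->]; case: (if b then k else 0) => [|{}k] /=.
  by case: l => //= l; rewrite nrev count_nseq.
rewrite pairmap_cat count_cat nrev count_nseq /=.
have -> : last true (nseq k true) = true by elim: k.
by case: l => //= l; rewrite nrev count_nseq.
Qed.

Lemma phased_cons G (a : action G) (s : seq (action G)) (b b' : bool) :
  direction a != Some (~~ b) -> (b' -> b) -> phased b' (pmap (@direction G) s) ->
  phased b (pmap (@direction G) (a :: s)).
Proof.
move=> ab bb' [k [l /= e]]; case: a ab => [g||] //=; rewrite e.
- by case: b bb' => // _ _; exists (if b' then k else 0).+1, l.
- case: b bb' => // bb' _; case: b' bb' {e} => [/(_ isT)//|_].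
  by exists 0, l.+1.
case: b bb' => [_ _|bb' _]; first by exists (if b' then k else 0), l.
by case: b' bb' {e} => [/(_ isT)//|_]; exists 0, l.
Qed.

Lemma direction_entry p q a t1 t2 q' a1 a2 : entry p q a t1 t2 = Some (q', a1, a2) ->
  [/\ (2 < q' -> 2 < q), direction a1 != Some (q <= 2) & direction a2 != Some (q <= 2)].
Proof.
case: q => [|[|[|q]]] /=; first by case=> <- <- <-.
- by case: ifP => _ [<- <- <-].
- case: t1 t2 => [g|] [h|] //; last by case=> <- <- <-.
  by case: ifP => // _ [<- <- <-].
case: (onth p q) => [[[g|] r|r1 r0]|] //= [_ <- <-] //.
Qed.

(** States above 2 never pop, states 0, 1 and 2 never push, and no transition leads from the latter
    back to the former. *)
Lemma one_reversal_bounded_automaton p q0 : one_reversal_bounded (automaton p q0).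
Proof.
move=> w ms [c [rw _]].
suff phased_run q s1 s2 : @run (automaton p q0) (q, s1, s2) w = Some (ms, c) ->
    phased (2 < q) (pmap (@direction _) (unzip1 ms)) /\
    phased (2 < q) (pmap (@direction _) (unzip2 ms)).
  by have [/reversals_phased ? /reversals_phased] := phased_run _ _ _ rw.
elim: w q s1 s2 ms {rw} => [|a w IHw] q s1 s2 ms /=.
  by case=> <- _; split; exists 0, 0; case: ifP.
rewrite ffunE /=; case e: (entry _ _ _ _ _) => [[[q' a1] a2]|] //=.
case: (act a1 s1) => [s1'|] //; case: (act a2 s2) => [s2'|] //.
case rw: run => [[ms' c']|] // [<- cc']; rewrite cc' in rw.
have [p1 p2] := IHw _ _ _ _ rw; have [qq' d1 d2] := direction_entry e.
(* [inord] sends a target out of range to state 0, for which the implication is vacuous. *)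
have q'q : 2 < (inord q' : 'I_(size p).+3) -> 2 < q.
  rewrite /inord val_insubd; case: ifP => // _; exact: qq'.
by split; [apply: phased_cons p1 | apply: phased_cons p2] => //; rewrite -leqNgt.
Qed.

(** * Acceptance and halting *)

Lemma accepts2 p s1 s2 w : accepts p 2 s1 s2 w -> s1 = s2.
Proof.
elim: w s1 s2 => [|a w IHw] [|g s1] [|h s2] //=.
by case: eqP => //= -> /IHw->.
Qed.

Lemma accepts1 p s1 s2 w : accepts p 1 s1 s2 w -> exists t, s2 = t ++ s1.
Proof.
elim: w s1 s2 => [|a w IHw] s1 s2 //=; case: ifP => _ /=.
  by case: s2 => // h s2 /IHw[t ->]; exists (h :: t).
by move/accepts2->; exists [::].
Qed.

Lemma entry_fetch p q i a t1 t2 : fetch p q = Some i ->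
  entry p q a t1 t2 = match i with
    | Write o r => Some (r, Stay, oapp (@Push _) Stay o)
    | Read r1 r0 => Some (if a == sharp then r0 else r1, Push a, Stay)
    end.
Proof. by case: q => [|[|[|q]]] //= ->; case: i. Qed.

(** Stacks only grow until state 1 or 2 is reached, and from there acceptance forces stack 1 to be a
    bottom segment of stack 2. Hence the present contents have a common extension: counted from the
    bottom, they agree wherever both are defined. *)
Lemma accepts_compatible p q s1 s2 w : all (wf (size p).+3) p -> 0 < q ->
  accepts p q s1 s2 w -> exists t1 t2, t1 ++ s1 = t2 ++ s2.
Proof.
move=> pwf; elim: w q s1 s2 => [|a w IHw] q s1 s2 q_gt0; first by case: q q_gt0.
case: (posnP (q.-2)) => [q2|q2].
  case: q q_gt0 q2 => [|[|[|q]]] // _ _; first by case/accepts1=> t ->; exists t, [::].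
  by move/accepts2->; exists [::], [::].
have -> : q = q.-2.-1.+3 by lia.
rewrite [accepts _ _ _ _ _]/=.
case e: (onth p _) => [i|] //; have := fetch_wf (q := q.-2.-1.+3) pwf e.
case: i {e} => [o r|r1 r0]; rewrite /wf /= ?andbT => r_gt0.
  have {r_gt0} /andP[r_gt0 _] := r_gt0.
  case: o => [g|] /= /(IHw _ _ _ r_gt0)[t1 [t2 e]]; last by exists t1, t2.
  by exists t1, (rcons t2 g); rewrite cat_rcons.
have q'_gt0 : 0 < if a == sharp then r0 else r1.
  by case: ifP => _; case/andP: r_gt0 => /andP[? _] /andP[].
move=> /(IHw _ _ _ q'_gt0)[t1 [t2 e]].
by exists (rcons t1 a), t2; rewrite cat_rcons.
Qed.

Lemma accepts_reach p c d u w : all (wf (size p).+3) p -> reach p c d ->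
  accepts p c.1 (rev u) (rev (u ++ c.2)) w ->
  exists v w', accepts p d.1 (rev v) (rev (v ++ d.2)) w'.
Proof.
move=> pwf cd; elim: cd u w => {c d} [c|[q l] d e qd _ IH] u w; first by exists u, w.
move: qd; rewrite /qstep /=; case pq: (fetch p q) => [i|] // qd.
case: w => [|a w] /=; first by case: q pq {qd}.
rewrite (entry_fetch _ _ _ pq).
case: i qd pq => [o r [de] _|r1 r0]; first (rewrite -{}de in IH).
  by case: o IH => [g|] /= IH aw; apply: (IH u w); rewrite -?rcons_cat ?rev_rcons.
case: l => // b l [de]; rewrite -de in IH => /(fetch_wf pwf).
rewrite /wf /= andbT => r_gt0 /= aw.
have ab : a = b.
  have q'_gt0 : 0 < if a == sharp then r0 else r1.
    by case: ifP => _; case/andP: r_gt0 => /andP[? _] /andP[].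
  have [t1 [t2]] := accepts_compatible pwf q'_gt0 aw.
  (* At position [size u] from the bottom, stack 1 holds the guess [a] and stack 2 the symbol [b]
     that the queue machine reads. *)
  move/(congr1 (fun s => nth a (rev s) (size u))).
  rewrite (rev_cat t1) (rev_cat t2) rev_cons !revK nth_cat size_rcons ltnSn.
  by rewrite nth_rcons ltnn eqxx -catA nth_cat ltnn subnn.
by apply: (IH (rcons u b) w); rewrite rev_rcons cat_rcons /= -{1 2}ab.
Qed.

(** Conversely, the input supplies the correct guess at each [Read]; at a [Write] any letter will
    do, and [sharp] is taken. *)
Lemma reach_accepts p c d u : reach p c d ->
  (forall v, exists w, accepts p d.1 (rev v) (rev (v ++ d.2)) w) ->
  exists w, accepts p c.1 (rev u) (rev (u ++ c.2)) w.
Proof.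
move=> cd dw; elim: cd dw u => {c d} [c|[q l] d e qd _ IH] ew u; first exact: ew.
move: qd; rewrite /qstep /=; case pq: (fetch p q) => [[o r|r1 r0]|] //.
  move=> [de]; have [w] := IH ew u; rewrite -de => dw.
  exists (sharp :: w) => /=; rewrite (entry_fetch _ _ _ pq).
  by case: o dw de pq => [g|] /=; rewrite -?rcons_cat ?rev_rcons.
case: l => // b l [de]; have [w] := IH ew (rcons u b); rewrite -de => dw.
exists (b :: w) => /=; rewrite (entry_fetch _ _ _ pq) /=.
by rewrite -rev_rcons -cat_rcons.
Qed.

Lemma accepts_halted p u l : exists w, accepts p 1 (rev u) (rev (u ++ l)) w.
Proof.
(* The first sharps pop the unread word [l], the stroke starts the comparison, [size u] sharps pop
   the equal stacks, and one more leads to state 0. *)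
exists (nseq (size l) sharp ++ stroke :: nseq (size u).+1 sharp).
rewrite rev_cat -(size_rev l); elim: (rev l) => [|b s IHs] //=.
rewrite -(size_rev u).
by elim: (rev u) => //= b s IHs; rewrite eqxx.
Qed.

Lemma accepts_diverging p q s1 s2 w g : fetch p q = Some (Write (Some g) q) ->
  ~~ accepts p q s1 s2 w.
Proof.
move=> pq; elim: w s2 => [|a w IHw] s2 /=; first by case: q pq.
rewrite (entry_fetch _ _ _ pq) /=; exact: IHw.
Qed.

Lemma dense_halting p q0 l : all (wf (size p).+3) p -> q0 < (size p).+3 ->
  reach p (q0, [::]) (1, l) -> dense (@lang (automaton p q0)).
Proof.
move=> pwf q0n /(@reach_accepts _ _ _ [::]) H; apply/(dense_automaton pwf q0n)/H.
by move=> v; apply: accepts_halted.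
Qed.

Lemma dense_diverging p q0 q l g : all (wf (size p).+3) p -> q0 < (size p).+3 ->
  reach p (q0, [::]) (q, l) -> fetch p q = Some (Write (Some g) q) ->
  ~ dense (@lang (automaton p q0)).
Proof.
move=> pwf q0n r pq /(dense_automaton pwf q0n)[w aw].
have [v [w']] := accepts_reach (u := [::]) pwf r aw.
by rewrite (negPf (accepts_diverging _ _ _ pq)).
Qed.

(** * Codes of automata and self-reference *)

(** A version of [code_entry] with plain numbers as states, so that the codes of the entries of a
    program do not depend on the size of the automaton containing it. *)
Definition code_step (e : option (nat * action 'I_2 * action 'I_2)) : nat :=
  CodeSeq.code (if e is Some (q, a1, a2) then [:: q; code_action a1; code_action a2]
                else [::]).

Definition block p q : seq nat :=
  [seq code_step (entry p q x.1.1 x.1.2 x.2)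
     | x : 'I_2 * option 'I_2 * option 'I_2].

Lemma enum_prod (T U : finType) :
  enum {: T * U} = [seq (x, y) | x <- enum T, y <- enum U].
Proof. by rewrite [LHS]enumT unlock. Qed.

(** Both groupings give the lexicographic order; regrouping makes the state the outermost index of
    the table. *)
Lemma enum_prod_assoc (T U V : finType) :
  enum {: T * U * V} = [seq (x.1, x.2.1, x.2.2) | x : T * (U * V)].
Proof.
rewrite /image_mem !enum_prod.
elim: (enum T) => //= x s IHs; rewrite allpairs_cat map_cat IHs; congr (_ ++ _).
by elim: (enum U) => //= y r ->; rewrite !map_cat -!map_comp.
Qed.

Lemma codom_block p q0 : all (wf (size p).+3) p ->
  [seq code_entry e | e <- codom (trans (automaton p q0))] =
  flatten [seq block p q | q <- iota 0 (size p).+3].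
Proof.
move=> pwf; rewrite /codom -map_comp enum_prod_assoc /image_mem -map_comp.
rewrite enum_prod_assoc /image_mem -map_comp enum_prod map_allpairs.
rewrite -[(size p).+3 in RHS]/((size p).+3) -val_enum_ord -map_comp.
congr flatten; apply: eq_map => q /=.
rewrite /block /image_mem enum_prod_assoc /image_mem -[RHS]map_comp.
apply: eq_map => -[a [t1 t2]] /=; rewrite ffunE.
case e: entry => [[[q' a1] a2]|] //=.
by rewrite /code_entry inordK ?(entry_in_range pwf e).
Qed.

Lemma code_automaton p q0 : all (wf (size p).+3) p -> q0 < (size p).+3 ->
  code_dpda2 (automaton p q0) =
  CodeSeq.code ([:: (size p).+3; 2; 2; 2; q0] ++ 1 :: nseq (size p).+2 0 ++
                flatten [seq block p q | q <- iota 0 (size p).+3]).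
Proof.
move=> pwf q0n; rewrite /code_dpda2 codom_block //.
rewrite -cat_cons; congr (CodeSeq.code (_ ++ _ ++ _)); first by rewrite /= inordK.
rewrite /image_mem enum_ordSl /= inE eqxx -map_comp; congr (_ :: _).
rewrite -[RHS]/(nseq (size p).+2 0) -[in RHS](size_enum_ord (size p).+2).
by elim: (enum _) => //= i s <-; rewrite inE.
Qed.

(** The code of [x :: l] is [2 ^ x.+1] times that of [l], plus [2 ^ x]. Prepending a list is thus
    affine on codes, and [code_mult] is the slope. *)
Fixpoint code_mult (l : seq nat) := if l is x :: l' then 2 ^ x.+1 * code_mult l' else 1.

Lemma code_cat l l' :
  CodeSeq.code (l ++ l') = code_mult l * CodeSeq.code l' + CodeSeq.code l.
Proof.
elim: l => [|x l IHl] /=; first by rewrite mul1n addn0.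
by rewrite -/(CodeSeq.code _) IHl expnS -/(CodeSeq.code _); lia.
Qed.

Lemma code_nseq_cat k x l :
  CodeSeq.code (nseq k x ++ l) = iter k (code_cons x) (CodeSeq.code l).
Proof. by elim: k => //= k ->. Qed.

(** * Loaders and their codes *)

Fixpoint load off w e : seq instr :=
  if w is g :: w' then Write (Some g) off.+1 :: load off.+1 w' e
  else [:: Write None e].

Lemma size_load off w e : size (load off w e) = (size w).+1.
Proof. by elim: w off => //= g w IHw off; rewrite IHw. Qed.

Lemma wf_load n off w e : 0 < e < n -> off + size w < n -> all (wf n) (load off w e).
Proof.
move=> en; elim: w off => [|g w IHw] off /= offn; first by rewrite /wf /= en.
by rewrite IHw /wf /=; lia.
Qed.

Lemma reach_load p off w e l : code_at p off (load off w e) ->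
  reach p (off, l) (e, l ++ w).
Proof.
elim: w off l => [|g w IHw] off l /= /code_at_cons[p0 pw].
  by apply: (reach_write p0); rewrite cats0; constructor.
by apply: (reach_write p0) => /=; rewrite -cat_rcons; apply: IHw.
Qed.

Definition nentries := #|{: 'I_2 * option 'I_2 * option 'I_2}|.

Definition code_write (o : option 'I_2) r :=
  code_cons r (CodeSeq.code [:: 0; code_action (oapp (@Push _) Stay o)]).

Lemma block_write p q o r : fetch p q = Some (Write o r) ->
  block p q = nseq nentries (code_write o r).
Proof.
move=> pq; rewrite /block /nentries cardE /image_mem.
elim: (enum _) => //= x s ->; congr (_ :: _).
by rewrite (entry_fetch _ _ _ pq).
Qed.

(** The code of the blocks of a loader, built as a number by recursion on the word, in a form whose
    computability can be shown. *)
Fixpoint code_load off w e :=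
  iter nentries
    (code_cons (if w is g :: _ then code_write (Some g) off.+1 else code_write None e))
    (if w is _ :: w' then code_load off.+1 w' e else 0).

Lemma code_loadE p off w e : code_at p off (load off w e) ->
  CodeSeq.code (flatten [seq block p q | q <- iota off (size w).+1]) = code_load off w e.
Proof.
elim: w off => [|g w IHw] off /code_at_cons[p0 pw].
  by rewrite /= (block_write p0) code_nseq_cat.
by rewrite /= (block_write p0) code_nseq_cat -IHw.
Qed.

(** Turns a run of variable length [x] into a primitive recursion. The code is built from the last
    state backwards: pass [j] adds the state whose target is [off + x - j]. *)
Lemma code_load_nseq off x g w e :
  code_load off (nseq x g ++ w) e =
  iteri x (fun j v => iter nentries (code_cons (code_write (Some g) (off + x - j))) v)
    (code_load (off + x) w e).
Proof.
have H j : j <= x ->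
    code_load (off + x - j) (nseq j g ++ w) e =
    iteri j (fun j v => iter nentries (code_cons (code_write (Some g) (off + x - j))) v)
      (code_load (off + x) w e).
  elim: j => [|j IHj] jx; first by rewrite subn0.
  rewrite /= -IHj ?(ltnW jx) //.
  by have -> : (off + x - j.+1).+1 = off + x - j by lia.
by rewrite -H // addnK.
Qed.

Lemma computable_iter_code_cons n k (E Z : n.-tuple nat -> nat) :
  computable E -> computable Z ->
  computable (fun xs => iter k (code_cons (E xs)) (Z xs)).
Proof. by move=> cE cZ; elim: k => //= k; apply: computable_code_cons. Qed.

Lemma wf_leq n n' i : n <= n' -> wf n i -> wf n' i.
Proof. by move=> nn'; apply: sub_all => r /andP[-> /leq_trans->]. Qed.

Lemma computable_iter_code_consX n (E X Z : n.-tuple nat -> nat) :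
  computable E -> computable X -> computable Z ->
  computable (fun xs => iter (X xs) (code_cons (E xs)) (Z xs)).
Proof.
move=> cE cX cZ.
apply: eq_computable (computable_iteri (g := fun _ v xs => code_cons (E xs) v) _ cZ cX).
  by move=> xs; elim: (X xs) => //= x ->.
apply: computable_code_cons; first exact: computable_behead (computable_behead cE).
exact/computable_behead/computable_head.
Qed.

Lemma computable_code_write n o (R : n.-tuple nat -> nat) :
  computable R -> computable (fun xs => code_write o (R xs)).
Proof. by move=> cR; apply: computable_code_cons => //; apply: computable_const. Qed.

Lemma computable_code_load_nseq n g (w : n.-tuple nat -> seq 'I_2) e
    (O X : n.-tuple nat -> nat) :
  computable O -> computable X ->
  computable (fun xs => code_load (O xs + X xs) (w xs) e) ->
  computable (fun xs => code_load (O xs) (nseq (X xs) g ++ w xs) e).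
Proof.
move=> cO cX cw.
apply: eq_computable (computable_iteri (g := fun j v xs =>
  iter nentries (code_cons (code_write (Some g) (O xs + X xs - j))) v) _ cw cX).
  by move=> xs; rewrite code_load_nseq.
apply: computable_iter_code_cons; last exact/computable_behead/computable_head.
apply/computable_code_write/computable_sub; last exact: computable_head.
exact: computable_behead (computable_behead (computable_add cO cX)).
Qed.

Lemma computable_code_load_cons n g (w : n.-tuple nat -> seq 'I_2) e
    (O : n.-tuple nat -> nat) :
  computable O -> computable (fun xs => code_load (O xs).+1 (w xs) e) ->
  computable (fun xs => code_load (O xs) (g :: w xs) e).
Proof.
move=> cO cw; apply: computable_iter_code_cons => //.
exact/computable_code_write/computable_succ.
Qed.

Definition input_word a b c := enc [:: a; b; c].

(* For p0 of size c - 3 such that the code of [l ++ l'], where l lists the    *)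
(* entries of p0, is a * code l' + b, this is the code of the automaton that  *)
(* stores a, b and c in the queue and then runs p0.                           *)
Definition self_code a b c :=
  let n := c + (a + b + c + 4) in
  code_cons n (code_cons 2 (code_cons 2 (code_cons 2 (code_cons c
    (code_cons 1 (iter (n - 1) (code_cons 0)
      (a * code_load c (input_word a b c) 3 + b))))))).

Lemma computable_self_code :
  computable (fun xs : 3.-tuple nat =>
    self_code (nth 0 xs 0) (nth 0 xs 1) (nth 0 xs 2)).
Proof.
have c_nth (i : 'I_3) : computable (fun xs : 3.-tuple nat => nth 0 xs i).
  by apply: eq_computable (computable_proj i) => xs; rewrite (tnth_nth 0).
have cA := c_nth ord0; have cB := c_nth (inord 1); have cC := c_nth (inord 2).
rewrite !inordK // in cB cC.
rewrite /self_code.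
(* Three runs of variable length separated by single letters, so that the two lemmas on [code_load]
   apply alternately. *)
have iE x y z : input_word x y z = nseq x stroke ++ sharp :: nseq y stroke ++
    sharp :: nseq z stroke ++ [:: sharp].
  by rewrite /input_word !enc_cons !cat_rcons.
apply: eq_computable; first by move=> xs; rewrite iE; reflexivity.
have cN := computable_add cC (computable_add (computable_add (computable_add cA cB) cC)
  (computable_const 3 4)).
do !apply: computable_code_cons => //; try exact: computable_const.
apply: computable_iter_code_consX; first exact: computable_const.
  by apply: computable_sub => //; apply: computable_const.
apply: computable_add => //; apply: computable_mul => //.
have cCA := computable_add cC cA.
have cCAB := computable_add (computable_succ cCA) cB.
apply: computable_code_load_nseq => //.
apply: computable_code_load_cons => //.
apply: computable_code_load_nseq => //; first exact: computable_succ.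
apply: computable_code_load_cons => //.
apply: computable_code_load_nseq => //; first exact: computable_succ.
apply: computable_code_load_cons.
  by apply: computable_add => //; apply: computable_succ.
by apply: computable_iter_code_cons; apply: computable_const.
Qed.

Lemma code_at_suffix p c : code_at (p ++ c) (size p).+3 c.
Proof. by move=> i _; rewrite /fetch !addSn onth_cat ltnNge leq_addr addKn. Qed.

(** The fixed-point equation: the numbers put in the queue determine the code of the automaton that
    puts them there. The loader starts at state [c], just after [p0], and ends by jumping to 3, the
    first instruction of [p0]. *)
Lemma self_codeE p0 :
  let a := code_mult (flatten [seq block p0 q | q <- iota 0 (size p0).+3]) in
  let b := CodeSeq.code (flatten [seq block p0 q | q <- iota 0 (size p0).+3]) in
  let c := (size p0).+3 in
  all (wf (size p0).+3) p0 -> 0 < size p0 ->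
  self_code a b c =
  code_dpda2 (automaton (p0 ++ load c (input_word a b c) 3) c).
Proof.
set l := flatten _ => a b c p0wf p0_gt0.
set w := input_word a b c; set L := load _ _ _; set p := p0 ++ L.
(* There are [a + b + c] strokes, three sharps and the final jump. *)
have sL : size L = a + b + c + 4.
  by rewrite size_load /w /input_word !enc_cons !size_cat !size_rcons !size_nseq /=; lia.
have sp : (size p).+3 = c + size L by rewrite size_cat.
have pwf : all (wf (size p).+3) p.
  rewrite all_cat sp; apply/andP; split; last first.
    by apply: wf_load; move: sL; rewrite size_load -/w; lia.
  by apply: sub_all p0wf => i; apply: wf_leq; apply: leq_addr.
rewrite code_automaton //; last by rewrite sp sL; lia.
rewrite /self_code -sL -sp subn1 sp iotaD map_cat flatten_cat -sp.
(* Appending the loader does not alter the instructions fetched in the states of [p0]. *)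
have -> : [seq block p q | q <- iota 0 c] = [seq block p0 q | q <- iota 0 c].
  apply/eq_in_map => q; rewrite mem_iota /= => qc; apply: eq_map => x.
  case: q qc => [|[|[|q]]] // qc; congr code_step.
  by rewrite /= onth_cat ifT.
have Lcode :
    CodeSeq.code (flatten [seq block p q | q <- iota c (size L)]) = code_load c w 3.
  by rewrite size_load; apply/code_loadE/code_at_suffix.
rewrite add0n -/l -Lcode -code_cat -code_nseq_cat.
by [].
Qed.

(** The program adds empty registers, computes [F] into register 3, rotates the three inputs away
    and reads the first symbol of the result: a sharp means zero and leads to state 1, a stroke
    leads to an endless loop of writing. *)
Lemma exists_program (F : recf 3) : exists2 p0, all (wf (size p0).+3) p0 &
  0 < size p0 /\
  forall (xs : 3.-tuple nat) y p, eval F xs y -> exists q l,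
    reach (p0 ++ p) (3, enc xs) (q, l) /\
    if y is 0 then q = 1 else fetch (p0 ++ p) q = Some (Write (Some stroke) q).
Proof.
pose P := gen F id 3; pose k := maxn 4 (bound P).
(* Instructions start at 3; the first part writes [k - 3] sharps, each an empty register, and jumps,
   hence [k.+1]. The 9 counts three rotations of three instructions. *)
pose o1 := k.+1; pose c := qcomp k P o1; pose o2 := o1 + size c; pose o3 := o2 + 9.
pose p0 := load 3 (nseq (k - 3) sharp) o1 ++ c ++ rotates 3 o2 ++
  [:: Read o3.+1 1; Write (Some stroke) o3.+1].
have k4 : 4 <= k by rewrite leq_maxl.
have Pk : bound P <= k by rewrite leq_maxr.
have sp0 : (size p0).+3 = o3.+2.
  by rewrite /p0 !size_cat size_load size_nseq /=; lia.
exists p0.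
  rewrite sp0 /p0 3!all_cat; apply/and4P; split.
  - by apply: wf_load; rewrite ?size_nseq /o3 /o2 /o1; lia.
  - by apply: wf_qcomp; rewrite -/c /o3 /o2 /o1; lia.
  - by apply: wf_rotates; rewrite /o3 /o2 /o1; lia.
  by rewrite /= /wf /= !andbT /o3; lia.
split=> [|xs y p ev]; first by move: sp0; rewrite /o3; lia.
have: code_at (p0 ++ p) 3 p0.
  by move=> i ip; have -> : 3 + i = i.+3 by []; rewrite /= onth_cat ip.
move=> /code_at_cat[a1]; rewrite size_load size_nseq.
have -> : 3 + (k - 3).+1 = o1 by lia.
move=> /code_at_cat[a2 /code_at_cat[a3]]; rewrite -/o2 size_rotates.
move=> /code_at_cons[a4 /code_at_cons[a5 _]].
have [t st [t3 _]] : wp P (nth 0 xs)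
    (fun t => t 3 = y /\ forall i, i < 3 -> t i = nth 0 xs i).
  exact: wp_gen ev _ _.
have xsE : enc xs ++ nseq (k - 3) sharp = enc (mkseq (nth 0 xs) k).
  have -> : mkseq (nth 0 xs) k = xs ++ nseq (k - 3) 0.
    apply: (@eq_from_nth _ 0) => [|i]; rewrite size_mkseq.
      by rewrite size_cat size_tuple size_nseq; lia.
    move=> ik; rewrite nth_mkseq // nth_cat size_tuple nth_nseq if_same.
    by case: ltnP => // i3; rewrite nth_default ?size_tuple.
  by rewrite enc_cat; congr (_ ++ _); elim: (k - 3) => //= j ->.
have r1 := reach_load (enc xs) a1; rewrite xsE in r1.
have r2 := reach_trans r1 (reach_qcomp st Pk a2).
rewrite (mkseq_split t k4) enc_cat in r2.
have r3 := reach_trans r2 (@reach_rotates _ _ (mkseq t 3) _ a3).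
rewrite size_mkseq enc_cons t3 in r3.
case: y {ev t3} r3 => [|y] r3.
  by eexists; eexists; split; first apply: reach_trans r3 (reach_read a4 (ReachRefl _ _)).
eexists; eexists; split; first apply: reach_trans r3 (reach_read a4 (ReachRefl _ _)).
exact: a5.
Qed.

Theorem corollary9 :
  ~ decidable_on code_dpda2 one_reversal_bounded (fun M => dense (@lang M)).
Proof.
case=> f fP; have [s sP] := computable_self_code.
(* [p0] computes the code of its own automaton by [s] and submits it to [f]. *)
have [p0 p0wf [p0_gt0 p0P]] := exists_program (Comp f (fun=> s)).
have := self_codeE p0wf p0_gt0.
set a := code_mult _; set b := CodeSeq.code _; set c := (size p0).+3.
set L := load _ _ _; set p := p0 ++ L => e.
have sp : (size p).+3 = c + size L by rewrite size_cat.
have sL : size L = (size (input_word a b c)).+1 by rewrite size_load.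
have pwf : all (wf (size p).+3) p.
  rewrite all_cat sp; apply/andP; split; last by apply: wf_load; rewrite ?sL; lia.
  by apply: sub_all p0wf => i; apply: wf_leq; apply: leq_addr.
have cp : c < (size p).+3 by rewrite sp sL; lia.
have [y [fy dy]] := fP _ (@one_reversal_bounded_automaton p c).
have ev : eval (Comp f (fun=> s)) [tuple a; b; c] y.
  exists [tuple code_dpda2 (automaton p c)]; split=> // i.
  by rewrite (ord1 i) -e; apply: sP.
have [q [l [r qy]]] := p0P _ _ L ev.
have r0 : reach p (c, [::]) (3, input_word a b c).
  by apply: reach_load; apply: code_at_suffix.
(* If the answer is true, the queue machine writes forever and the language is not dense; if it is
   false, the machine halts and the language is dense. *)
case: y {fy ev} qy dy => /= pq [d1 d2].
  exact: dense_diverging pwf cp (reach_trans r0 r) pq (d2 isT).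
have //: false by rewrite pq in r; apply/d1/(dense_halting pwf cp (reach_trans r0 r)).
Qed.
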